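(* There exists an undirected, simple temporal graph $\mathcal{G}=(V,E,\lambda)$ such that no undirected, simple temporal graph $\mathcal{H}$ on the same vertex set $V$ satisfies $\mathcal{R}_{\mathrm{strict}}(\mathcal{H})\simeq\mathcal{R}_{\mathrm{non\text{-}strict}}(\mathcal{G})$. Here $\mathcal{R}_{\mathrm{non\text{-}strict}}(\mathcal{G})$ is the reachability graph of $\mathcal{G}$ computed with non-strict temporal paths and $\mathcal{R}_{\mathrm{strict}}(\mathcal{H})$ is the reachability graph of $\mathcal{H}$ computed with strict temporal paths. In other words, some graph in the setting UD \& non-strict \& simple has no reachability equivalent graph in the setting UD \& strict \& simple.
   Context: An undirected temporal graph is a triple $\mathcal{G}=(V,E,\lambda)$ with $V$ a finite vertex set, $E$ a set of 2-element subsets of $V$ (the footprint is $(V,E)$), and $\lambda\colon E\to 2^{\mathbb{N}}\setminus\{\emptyset\}$ assigning to each edge a nonempty finite set of time labels; a temporal edge is a pair $(e,t)$ with $t\in\lambda(e)$. $\mathcal{G}$ is simple if $|\lambda(e)|=1$ for every edge $e$. A temporal path from $u$ to $v$ is a sequence of temporal edges $(e_1,t_1),\dots,(e_k,t_k)$, $k\ge 1$, such that $e_1,\dots,e_k$ form a path from $u$ to $v$ in the footprint (distinct vertices) and $t_1\le t_2\le\dots\le t_k$; it is strict if $t_1<t_2<\dots<t_k$. In the strict setting reachability is defined by strict temporal paths, in the non-strict setting by all temporal paths. The reachability graph $\mathcal{R}(\mathcal{G})$ is the static directed graph on $V$ having an arc $(u,v)$, $u\neq v$, iff there is a temporal path (of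 the kind prescribed by the setting) from $u$ to $v$. Two temporal graphs on the same vertex set are reachability equivalent if their reachability graphs are isomorphic. *)

(* Defs.v *)
From mathcomp Require Import all_boot.
From mathcomp Require Import finmap.

Set Implicit Arguments.
Unset Strict Implicit.
Unset Printing Implicit Defensive.

(* The values of [tlabels] outside [tedges] are junk: every notion below
   consults [tlabels] only on edges of the footprint. *)
Record tgraph (V : finType) := TGraph {
  tedges : {set {set V}};
  tlabels : {set V} -> {fset nat};
  tedges_card2 : forall e, e \in tedges -> #|e| = 2;
  tlabels_neq0 : forall e, e \in tedges -> tlabels e <> fset0
}.

Definition simple_tgraph (V : finType) (G : tgraph V) : Prop :=
  forall e, e \in tedges G -> #|` tlabels G e| = 1.

Definition temporal_edge (V : finType) (G : tgraph V) (a : {set V} * nat) :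
    bool :=
  (a.1 \in tedges G) && (a.2 \in tlabels G a.1).

Variant setting := Strict | NonStrict.

Definition time_order (s : setting) : rel nat :=
  match s with Strict => ltn | NonStrict => leq end.

(* [path_edges u p] is the sequence of edges traversed by the walk visiting
   [u] and then the vertices of [p] in order. *)
Definition path_edges (V : finType) (u : V) (p : seq V) : seq {set V} :=
  pairmap (fun x y => [set x; y]) u p.

Definition temporal_path (s : setting) (V : finType) (G : tgraph V)
    (u v : V) (a : seq ({set V} * nat)) : Prop :=
  [/\ 0 < size a,
      all (temporal_edge G) a,
      exists p : seq V,
        [/\ unzip1 a = path_edges u p, uniq (u :: p) & last u p = v]
    & sorted (time_order s) (unzip2 a)].

Definition digraph (V : finType) := V -> V -> Prop.

Definition reach_graph (s : setting) (V : finType) (G : tgraph V) :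
    digraph V :=
  fun u v => u <> v /\ exists a, temporal_path s G u v a.

Definition digraph_iso (V W : finType) (D : digraph V) (D' : digraph W) :
    Prop :=
  exists2 f : V -> W, bijective f & forall u v, D u v <-> D' (f u) (f v).

(* Main.v *)
Require Import Defs.
From mathcomp Require Import all_boot.
From mathcomp Require Import finmap.

Set Implicit Arguments.
Unset Strict Implicit.
Unset Printing Implicit Defensive.

(* The witness has six vertices and footprint labels 1 : {01, 02},
   2 : {14, 23}, 3 : {15, 24}, 4 : {12}; it was found by computer search.  In a
   strict simple temporal graph, the relation "u reaches v by a strict path with
   labels < t" determines its successor from the set of edges labelled t, and
   these sets are disjoint for distinct t.  An edge can only be used when it
   creates no arc outside of the target reachability graph; this leaves so few
   choices that an exhaustive exploration of all sequences of edge sets shows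
   that the target is never attained. *)

(** * Paths in simple temporal graphs as vertex sequences *)

(** On a singleton label set the maximum is just a total way to extract the only label. *)
Definition label (V : finType) (G : tgraph V) (e : {set V}) : nat :=
  \max_(t <- tlabels G e) t.

Lemma simple_labels (V : finType) (G : tgraph V) (e : {set V}) (t : nat) :
  simple_tgraph G -> e \in tedges G -> (t \in tlabels G e) = (t == label G e).
Proof.
move=> Gs /Gs/eqP/cardfs1P[l El].
by rewrite /label El in_fset1 big_seq_fset1.
Qed.

Definition labelled_path (s : setting) (V : finType) (G : tgraph V)
    (u : V) (p : seq V) : bool :=
  all (mem (tedges G)) (path_edges u p) &&
  sorted (time_order s) (map (label G) (path_edges u p)).

(** Each edge of a simple graph has a forced time, so the vertex sequence determines the temporal
    path. *)
Lemma simple_reachP (s : setting) (V : finType) (G : tgraph V) (u v : V) :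
  simple_tgraph G ->
  reach_graph s G u v <->
  u <> v /\ exists p, [/\ uniq (u :: p), last u p = v & labelled_path s G u p].
Proof.
move=> Gs; split=> -[neq_uv].
  case=> a [_ aG [p [a1 p_uniq p_last]] a_sorted]; split=> //; exists p.
  have a2 : unzip2 a = map (label G) (unzip1 a).
    elim: a aG {a1 a_sorted} => //= [[e t] a IH] /andP[/andP[/= eG te] /IH->].
    by move: te; rewrite simple_labels // => /eqP->.
  split=> //; rewrite /labelled_path -a1 -a2 a_sorted andbT all_map.
  by apply: sub_all aG => -[e t] /andP[].
case=> p [p_uniq p_last /andP[pG p_sorted]]; split=> //.
exists [seq (e, label G e) | e <- path_edges u p]; split.
- case: p p_last {p_uniq pG p_sorted} => //.
- rewrite all_map; apply: sub_all pG => e eG /=.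
  by rewrite /temporal_edge [_ \in _]eG simple_labels ?eqxx.
- by exists p; split=> //; rewrite /unzip1 -map_comp map_id.
- by rewrite /unzip2 -map_comp.
Qed.

(** * Strict reachability as a sweep over time *)

Section Sweep.
Variables (V : finType) (G : tgraph V).

Definition edge_at (t : nat) (x y : V) : bool :=
  ([set x; y] \in tedges G) && (label G [set x; y] == t).

(** The bound [t] is exclusive. Extension by an edge labelled [t'] reads the relation from before
    [t'], so two edges with equal labels are never chained: this encodes strictness. *)
Fixpoint reached (t : nat) (u v : V) : bool :=
  if t is t'.+1 then
    reached t' u v || [exists w, edge_at t' w v && reached t' u w]
  else u == v.

Lemma edge_atC t x y : edge_at t x y = edge_at t y x.
Proof. by rewrite /edge_at setUC. Qed.

Lemma edge_at_neq t x y : edge_at t x y -> x != y.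
Proof. by case/andP=> /tedges_card2; rewrite cards2; case: eqP. Qed.

Lemma reached_edge t x y z :
  edge_at t y z -> reached t x y -> reached t.+1 x z.
Proof.
by move=> yz xy; apply/orP; right; apply/existsP; exists y; rewrite yz.
Qed.

Lemma reached_mono t t' u v : t <= t' -> reached t u v -> reached t' u v.
Proof.
move=> le_tt' ruv; rewrite -(subnKC le_tt'); elim: (t' - t) => [|d IH].
  by rewrite addn0.
by rewrite addnS /= IH.
Qed.

Lemma path_edges_rcons (u : V) p x :
  path_edges u (rcons p x) = rcons (path_edges u p) [set last u p; x].
Proof. by elim: p u => //= y p IH u; rewrite IH. Qed.

Lemma path_edges_cat (u : V) p q :
  path_edges u (p ++ q) = path_edges u p ++ path_edges (last u p) q.
Proof. by elim: p u => //= y p IH u; rewrite IH. Qed.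

Lemma sorted_ltn_rcons (s : seq nat) x :
  sorted ltn (rcons s x) = sorted ltn s && all (ltn^~ x) s.
Proof.
rewrite -rev_sorted rev_rcons /= path_sortedE; last first.
  by move=> a b c /= ba ac; apply: ltn_trans ac ba.
by rewrite all_rev rev_sorted andbC.
Qed.

(** Strictness puts all earlier labels below the last one, so the path without its last edge is
    already covered when the sweep comes to that label. *)
Lemma path_reached u p t :
  labelled_path Strict G u p ->
  all (ltn^~ t) (map (label G) (path_edges u p)) -> reached t u (last u p).
Proof.
elim/last_ind: p t => [|p y IH] t.
  by move=> _ _; apply: (reached_mono (leq0n t)) => /=.
rewrite /labelled_path path_edges_rcons all_rcons map_rcons sorted_ltn_rcons.
rewrite all_rcons last_rcons => /andP[/andP[eG pG] /andP[ps pl]] /andP[lt_t _].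
apply: (reached_mono lt_t); apply: (@reached_edge _ _ (last u p)).
  by rewrite /edge_at [_ \in _]eG eqxx.
by apply: IH => //; rewrite /labelled_path pG.
Qed.

Lemma reached_path t u v :
  reached t u v -> exists p,
    [/\ uniq (u :: p), last u p = v, labelled_path Strict G u p
      & all (ltn^~ t) (map (label G) (path_edges u p))].
Proof.
elim: t v => [|t IH] v; first by move=> /eqP<-; exists [::].
rewrite [reached _ _ _]/=.
have weak s : all (ltn^~ t) s -> all (ltn^~ t.+1) s.
  by apply: sub_all => x; apply: leqW.
case/orP=> [/IH[p [? ? ? /weak ?]]|]; first by exists p.
case/existsP=> w /andP[/andP[eG /eqP el]] /IH[p [p_uniq p_last]].
move=> /andP[pG ps] pt.
have [v_p|v_p] := boolP (v \in u :: p); last first.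
  exists (rcons p v).
  rewrite -rcons_cons rcons_uniq v_p p_uniq last_rcons /labelled_path.
  rewrite path_edges_rcons p_last map_rcons !all_rcons sorted_ltn_rcons el.
  by split=> //; [rewrite [mem _ _]eG pG ps | rewrite /= ltnSn weak].
(* The sweep follows walks: here [v] already lies on the path to [w], and the prefix ending at [v]
   is the required path. *)
move: v_p; rewrite inE => /predU1P[->|v_p]; first by exists [::].
case/splitPr: v_p p_uniq pG ps pt {p_last} => p1 p2.
rewrite -cat_rcons -cat_cons cat_uniq path_edges_cat map_cat !all_cat.
move=> /and3P[p_uniq _ _] /andP[pG _] /cat_sorted2[ps _] /andP[pt _].
exists (rcons p1 v); rewrite last_rcons /labelled_path pG.
by split=> //; apply: weak.
Qed.

End Sweep.

(** * Boolean matrices and the exhaustive search *)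

(* Row [j] of a [bitmx] lists the vertices [i] that reach [j]. *)
Notation bitmx := (seq (seq bool)).
Definition bit (B : bitmx) (i j : nat) : bool := nth false (nth [::] B j) i.
Definition bits (n : nat) (r : nat -> nat -> bool) : bitmx :=
  mkseq (fun j => mkseq (fun i => r i j) n) n.

Lemma bit_bits n r i j : i < n -> j < n -> bit (bits n r) i j = r i j.
Proof. by move=> lt_i lt_j; rewrite /bit /bits !nth_mkseq. Qed.

Lemma eq_bits n r r' :
  (forall i j, i < n -> j < n -> r i j = r' i j) -> bits n r = bits n r'.
Proof.
move=> eq_r; rewrite /bits /mkseq; apply/eq_in_map => j.
rewrite mem_iota add0n => lt_j; apply/eq_in_map => i.
by rewrite mem_iota add0n => lt_i; apply: eq_r.
Qed.

Definition neighbours (S : seq (nat * nat)) (j : nat) : seq nat :=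
  [seq if e.1 == j then e.2 else e.1 | e <- S & (e.1 == j) || (e.2 == j)].

(** All rows are read from the old [B], so the edges of [S] act simultaneously; including [j] itself
    keeps the arcs already present. *)
Definition step (n : nat) (B : bitmx) (S : seq (nat * nat)) : bitmx :=
  mkseq (fun j =>
    let rows := [seq nth [::] B k | k <- j :: neighbours S j] in
    mkseq (fun i => has (fun row => nth false row i) rows) n) n.

Fixpoint sublists (T : Type) (s : seq T) : seq (seq T) :=
  if s is x :: s' then let r := sublists s' in map (cons x) r ++ r
  else [:: [::]].

Lemma filter_sublists (T : eqType) (P : pred T) (s : seq T) :
  filter P s \in sublists s.
Proof.
elim: s => //= x s IH; rewrite mem_cat; case: (P x); last by rewrite IH orbT.
by rewrite map_f.
Qed.

Definition row_le (r r' : seq bool) : bool := all2 implb r r'.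

(* Using [e] now creates no arc outside of [T]. *)
Definition usable (T B : bitmx) (e : nat * nat) : bool :=
  row_le (nth [::] B e.1) (nth [::] T e.2) &&
  row_le (nth [::] B e.2) (nth [::] T e.1).

(* [T] can be attained from [B] by rounds which each use up a
   nonempty set of the edges [rem] not used so far. *)
Fixpoint search (n : nat) (T : bitmx) (fuel : nat) (rem : seq (nat * nat))
    (B : bitmx) : bool :=
  (B == T) ||
  if fuel is k.+1 then
    has (fun S =>
        if S is [::] then false
        else search n T k [seq e <- rem | e \notin S] (step n B S))
      (sublists [seq e <- rem | usable T B e])
  else false.

Definition pairs (n : nat) : seq (nat * nat) :=
  [seq e <- allpairs pair (iota 0 n) (iota 0 n) | e.1 < e.2].

Lemma row_leP n (p q : nat -> bool) :
  reflect (forall i, i < n -> p i -> q i) (row_le (mkseq p n) (mkseq q n)).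
Proof.
rewrite /row_le /mkseq all2E !size_map eqxx zip_map all_map.
apply: (iffP allP) => [pq i lt_i|pq i].
  by move: (pq i); rewrite mem_iota add0n lt_i => /(_ isT)/implyP.
by rewrite mem_iota add0n => lt_i; apply/implyP/pq.
Qed.

Lemma mem_pairs n i j : ((i, j) \in pairs n) = (i < j < n).
Proof.
rewrite mem_filter /=; case: (ltnP i j) => //= lt_ij.
apply/allpairsP/idP => [[[a b] [_ + [_ ->]]]|lt_j].
  by rewrite mem_iota.
exists (i, j); rewrite !mem_iota /= !add0n; split=> //.
exact: ltn_trans lt_j.
Qed.

Lemma mem_neighbours S j k :
  (k \in neighbours S j) = ((k, j) \in S) || ((j, k) \in S).
Proof.
apply/mapP/idP => [[[a b]]|/orP[] eS].
- rewrite mem_filter /= => /andP[]; case: eqP => [->|_] /=.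
    by move=> _ eS ->; rewrite eS orbT.
  by move=> /eqP-> eS ->; rewrite eS.
- exists (k, j); first by rewrite mem_filter /= eqxx orbT.
  by rewrite /=; case: eqP.
- by exists (j, k); rewrite ?mem_filter /= eqxx.
Qed.

Lemma step_bits n r S :
  (forall e, e \in S -> e.1 < n /\ e.2 < n) ->
  step n (bits n r) S =
  bits n (fun i j => r i j || has (r i) (neighbours S j)).
Proof.
move=> S_lt; rewrite [RHS]/bits /step /mkseq; apply/eq_in_map => j.
rewrite mem_iota add0n => lt_j; apply/eq_in_map => i.
rewrite mem_iota add0n => lt_i /=.
rewrite -[nth _ (nth _ _ _) _]/(bit _ _ _) bit_bits // has_map.
congr (_ || _); apply: eq_in_has => k; rewrite mem_neighbours => kS.
have lt_k : k < n by case/orP: kS => /S_lt[].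
by rewrite /= -[nth _ _ _]/(bit _ _ _) bit_bits.
Qed.

(** * Completeness of the search *)

Section SearchComplete.
Variables (V : finType) (H : tgraph V) (n : nat) (g : nat -> V).
Hypothesis g_inj : forall i j, i < n -> j < n -> g i = g j -> i = j.
Hypothesis g_surj : forall v, exists2 i, i < n & v = g i.
Variable r : nat -> nat -> bool.
Variable m : nat.
Hypothesis r_upper :
  forall t i j, i < n -> j < n -> reached H t (g i) (g j) -> r i j.
Hypothesis r_reached :
  forall i j, i < n -> j < n -> r i j -> reached H m (g i) (g j).

Let state t := bits n (fun i j => reached H t (g i) (g j)).
Let used t (e : nat * nat) :=
  ([set g e.1; g e.2] \in tedges H) && (label H [set g e.1; g e.2] < t).
Let rest t := [seq e <- pairs n | ~~ used t e].
Let now t := [seq e <- pairs n | edge_at H t (g e.1) (g e.2)].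

Lemma state0 : state 0 = bits n (fun i j => i == j).
Proof.
apply: eq_bits => i j lt_i lt_j /=.
by apply/eqP/eqP => [/g_inj->|->].
Qed.

Lemma mem_now t a b :
  ((a, b) \in now t) = edge_at H t (g a) (g b) && (a < b < n).
Proof. by rewrite mem_filter mem_pairs. Qed.

Lemma now_lt t e : e \in now t -> e.1 < n /\ e.2 < n.
Proof.
case: e => a b; rewrite mem_now => /and3P[_ lt_ab lt_b].
by split=> //; apply: ltn_trans lt_b.
Qed.

(** [now t] lists each edge once, smaller end first; [neighbours] reads both orientations and no
    edge is a loop, so no extension is lost. *)
Lemma stateS t : state t.+1 = step n (state t) (now t).
Proof.
rewrite step_bits; last exact: now_lt.
apply: eq_bits => i j lt_i lt_j; rewrite [LHS]/=; congr (_ || _).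
apply/existsP/hasP => [[w /andP[]]|[k]].
  have [k lt_k ->] := g_surj w => kj ik; exists k => //.
  rewrite mem_neighbours !mem_now kj edge_atC kj /= lt_k lt_j.
  rewrite !andbT -neq_ltn; apply: contraTneq kj => ->.
  by apply/negP => /edge_at_neq/eqP.
rewrite mem_neighbours !mem_now (edge_atC H t (g j)) -andb_orr.
by move=> /andP[kj _] ik; exists (g k); rewrite kj.
Qed.

Lemma restS t : rest t.+1 = [seq e <- rest t | e \notin now t].
Proof.
rewrite /rest -[RHS]filter_predI; apply: eq_in_filter => e e_pair /=.
rewrite mem_filter e_pair andbT /edge_at /used ltnS leq_eqVlt.
by case: (_ \in _); rewrite //= negb_or.
Qed.

(** An edge labelled [t] creates only arcs of [reached] at [t.+1], which [r_upper] places in the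
    target. Being a filter of the candidate list, [now t] is among the sublists that [search]
    enumerates. *)
Lemma now_usable t :
  now t = [seq e <- [seq e <- rest t | usable (bits n r) (state t) e]
              | edge_at H t (g e.1) (g e.2)].
Proof.
rewrite /rest -2![RHS]filter_predI; apply: eq_in_filter => -[a b] e_pair /=.
case ab: (edge_at _ _ _ _) => //=.
have e_now : (a, b) \in now t by rewrite mem_filter ab.
have [lt_a lt_b] := now_lt e_now; apply/esym/andP; split; last first.
  by rewrite /used /=; case/andP: ab => -> /eqP->; rewrite ltnn.
have row f k : k < n -> nth [::] (bits n f) k = mkseq (f^~ k) n.
  by move=> lt_k; rewrite nth_mkseq.
rewrite /usable /state !row //; apply/andP; split; apply/row_leP => i lt_i ri.
  by apply: r_upper (reached_edge ab ri).
by rewrite edge_atC in ab; apply: r_upper (reached_edge ab ri).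
Qed.

(** Induction on [d], a bound on the time left until [m], when the target is complete. *)
Lemma search_from d t fuel :
  m <= t + d -> size (rest t) <= fuel ->
  search n (bits n r) fuel (rest t) (state t).
Proof.
elim: d t fuel => [|d IH] t fuel.
  rewrite addn0 => le_mt _; have -> : state t = bits n r.
    apply: eq_bits => i j lt_i lt_j; apply/idP/idP; first exact: r_upper.
    by move=> rij; apply: reached_mono le_mt (r_reached lt_i lt_j rij).
  by case: fuel => /=; rewrite eqxx.
rewrite addnS -addSn => le_m le_fuel.
(* A time carrying no edge changes neither the state nor the remaining pairs, so it is skipped
   without spending fuel. *)
have [now0|now_neq0] := eqVneq (now t) [::].
  have rest_eq : rest t.+1 = rest t by rewrite restS now0 filter_predT.
  have state_eq : state t.+1 = state t.
    rewrite stateS now0 step_bits //; apply: eq_bits => i j _ _.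
    by rewrite orbF.
  by rewrite -rest_eq -state_eq; apply: IH; rewrite ?rest_eq.
(* Any edge of [now t] is still in [rest t], so each actual round shrinks the remainder and pays for
   its unit of fuel. *)
have lt_size : size (rest t.+1) < size (rest t).
  rewrite restS size_filter -(count_predC (mem (now t)) (rest t)).
  rewrite -[ltnLHS]add0n ltn_add2r -has_count.
  case def_now: (now t) now_neq0 => [//|e s] _; apply/hasP; exists e.
    have : e \in now t by rewrite def_now mem_head.
    by rewrite now_usable !mem_filter => /and3P[].
  by rewrite inE mem_head.
case: fuel le_fuel => [|fuel le_fuel] /=; first by move/(leq_trans lt_size).
apply/orP; right; apply/hasP; exists (now t).
  by rewrite now_usable; apply: filter_sublists.
case def_now: (now t) now_neq0 => [//|e s] _; rewrite -def_now -restS -stateS.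
by apply: IH => //; rewrite -ltnS; apply: leq_trans le_fuel.
Qed.

Lemma search_complete :
  search n (bits n r) (size (pairs n)) (pairs n) (bits n (fun i j => i == j)).
Proof.
have rest0 : rest 0 = pairs n.
  by rewrite -[RHS]filter_predT; apply: eq_filter => e; rewrite /used andbF.
by rewrite -state0 -rest0; apply: (@search_from m); rewrite ?add0n.
Qed.

End SearchComplete.

(** * Simple temporal graphs from symmetric weight functions *)

Section WeightedGraph.
Variables (V : finType) (w : V -> V -> nat).
Hypothesis wC : forall x y, w x y = w y x.
Hypothesis wxx : forall x, w x x = 0.

(** On a pair the diagonal terms vanish and the two others agree, so the maximum recovers [w]
    without choosing an order of the endpoints. *)
Definition weight (e : {set V}) : nat := \max_(x in e) \max_(y in e) w x y.

Lemma weight2 x y : weight [set x; y] = w x y.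
Proof.
apply/eqP; rewrite eqn_leq; apply/andP; split.
  apply/bigmax_leqP => a /set2P a_xy; apply/bigmax_leqP => b /set2P b_xy.
  by case: a_xy => ->; case: b_xy => ->; rewrite ?wxx // wC.
apply: leq_trans (leq_bigmax_cond x (set21 x y)).
exact: (leq_bigmax_cond y (set22 x y)).
Qed.

Definition weighted_edges : {set {set V}} :=
  [set e : {set V} | (#|e| == 2) && (0 < weight e)].

Lemma weighted_edges_card2 e : e \in weighted_edges -> #|e| = 2.
Proof. by rewrite inE => /andP[/eqP]. Qed.

Lemma weighted_labels_neq0 e :
  e \in weighted_edges -> [fset weight e]%fset <> fset0.
Proof. by move=> _ /fsetP/(_ (weight e)); rewrite in_fset1 eqxx in_fset0. Qed.

Definition weighted_graph : tgraph V :=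
  TGraph weighted_edges_card2 weighted_labels_neq0.

Lemma weighted_graph_simple : simple_tgraph weighted_graph.
Proof. by move=> e _; apply: cardfs1. Qed.

Lemma weighted_labelled_path s x p :
  labelled_path s weighted_graph x p =
  path (fun y z => 0 < w y z) x p && sorted (time_order s) (pairmap w x p).
Proof.
have edges y q : all (mem weighted_edges) (path_edges y q)
    = path (fun y z => 0 < w y z) y q.
  elim: q y => //= z q IH y; rewrite IH !inE weight2 cards2.
  by have [->|_] := eqVneq y z; rewrite ?wxx.
have labels y q :
    map (label weighted_graph) (path_edges y q) = pairmap w y q.
  elim: q y => //= z q IH y.
  by rewrite IH /label big_seq_fset1 weight2.
by rewrite /labelled_path edges labels.
Qed.

End WeightedGraph.

(** * The witness and its non-strict reachability *)

(** Entry 0 stands for a non-edge, all labels being positive. *)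
Definition timing (i j : nat) : nat :=
  nth 0 (nth [::] [::
    [:: 0; 1; 1; 0; 0; 0];
    [:: 1; 0; 4; 0; 2; 3];
    [:: 1; 4; 0; 2; 3; 0];
    [:: 0; 0; 2; 0; 0; 0];
    [:: 0; 2; 3; 0; 0; 0];
    [:: 0; 3; 0; 0; 0; 0]] i) j.

Lemma forall_lt n (P : pred nat) :
  all P (iota 0 n) -> forall i, i < n -> P i.
Proof. by move=> /allP Pn i lt_i; apply: Pn; rewrite mem_iota. Qed.

Lemma timingC (i j : 'I_6) : timing i j = timing j i.
Proof.
have check : all (fun i => all (fun j => timing i j == timing j i) (iota 0 6))
    (iota 0 6) by [].
exact/eqP/(forall_lt (forall_lt check (ltn_ord i)) (ltn_ord j)).
Qed.

Lemma timing_diag (i : 'I_6) : timing i i = 0.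
Proof.
have check : all (fun i => timing i i == 0) (iota 0 6) by [].
exact/eqP/(forall_lt check (ltn_ord i)).
Qed.

Definition gadget : tgraph 'I_6 :=
  weighted_graph (fun i j : 'I_6 => timing i j).

(* Two rounds of [step] account for the non-strict walks with constant label,
   as each label class induces components of diameter at most 2. *)
Fixpoint reach_by (t : nat) : bitmx :=
  if t is t'.+1 then
    let S := [seq e <- pairs 6 | timing e.1 e.2 == t] in
    step 6 (step 6 (reach_by t') S) S
  else bits 6 (fun i j => i == j).

(** Induction step for non-strict paths, checked on all indices. The bound 5 is one above the
    largest label and keeps the new time within the checked range. *)
Lemma reach_by_edge t i x y :
  t < 5 -> i < 6 -> x < 6 -> y < 6 -> bit (reach_by t) i x ->
  0 < timing x y -> t <= timing x y ->
  bit (reach_by (timing x y)) i y && (timing x y < 5).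
Proof.
have check : all (fun t => all (fun i => all (fun x => all (fun y =>
    [&& bit (reach_by t) i x, 0 < timing x y & t <= timing x y] ==>
    bit (reach_by (timing x y)) i y && (timing x y < 5))
    (iota 0 6)) (iota 0 6)) (iota 0 6)) (iota 0 5).
  by vm_compute.
move=> lt_t lt_i lt_x lt_y ix xy0 xy.
move: (forall_lt (forall_lt (forall_lt (forall_lt check lt_t) lt_i) lt_x) lt_y).
by rewrite /= ix xy0 xy.
Qed.

Lemma reach_by_last t i x :
  t < 5 -> i < 6 -> x < 6 -> bit (reach_by t) i x -> bit (reach_by 4) i x.
Proof.
have check : all (fun t => all (fun i => all (fun x =>
    bit (reach_by t) i x ==> bit (reach_by 4) i x)
    (iota 0 6)) (iota 0 6)) (iota 0 5).
  by vm_compute.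
move=> lt_t lt_i lt_x; apply/implyP.
exact: (forall_lt (forall_lt (forall_lt check lt_t) lt_i) lt_x).
Qed.

Lemma reach_by_refl i : i < 6 -> bit (reach_by 4) i i.
Proof.
have check : all (fun i => bit (reach_by 4) i i) (iota 0 6) by vm_compute.
exact: (forall_lt check).
Qed.

Lemma reach_by_path (i x : 'I_6) p t :
  t < 5 -> bit (reach_by t) i x ->
  path (fun y z : 'I_6 => 0 < timing y z) x p ->
  path leq t (pairmap (fun y z : 'I_6 => timing y z) x p) ->
  bit (reach_by 4) i (last x p).
Proof.
elim: p x t => [|y p IH] x t lt_t ix /=.
  by move=> _ _; apply: reach_by_last ix.
move=> /andP[xy0 px] /andP[xy pt].
have /andP[iy lt_xy] :=
  reach_by_edge lt_t (ltn_ord i) (ltn_ord x) (ltn_ord y) ix xy0 xy.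
exact: IH lt_xy iy px pt.
Qed.

(** Stated on plain numbers so that it can be evaluated. *)
Definition journey (i : nat) (p : seq nat) : bool :=
  [&& uniq (i :: p), path (fun y z => 0 < timing y z) i p
    & sorted leq (pairmap timing i p)].

Lemma reach_by_journey (i j : 'I_6) :
  i != j -> bit (reach_by 4) i j ->
  exists p, [/\ all (ltn^~ 6) p, last (val i) p = j & journey i p].
Proof.
(* Every arc of the witness is realised by a path with at most two inner vertices. *)
pose candidates j := [:: j] :: [seq [:: a; j] | a <- iota 0 6] ++
  [seq [:: a; b; j] | a <- iota 0 6, b <- iota 0 6].
have check : all (fun i => all (fun j =>
    (i != j) && bit (reach_by 4) i j ==>
    has (fun p => [&& all (ltn^~ 6) p, last i p == j & journey i p])
      (candidates j)) (iota 0 6)) (iota 0 6).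
  by vm_compute.
move=> neq_ij ij; have ij2 : (val i != val j) && bit (reach_by 4) i j.
  exact/andP.
have /implyP/(_ ij2)/hasP[p _ /and3P[p6 /eqP pj ip]] :=
  forall_lt (forall_lt check (ltn_ord i)) (ltn_ord j).
by exists p.
Qed.

Lemma gadget_reachP (i j : 'I_6) :
  reach_graph NonStrict gadget i j <-> i <> j /\ bit (reach_by 4) i j.
Proof.
rewrite simple_reachP; last exact: weighted_graph_simple.
split=> -[neq_ij].
  case=> p [_ p_last]; rewrite weighted_labelled_path; last 2 first.
  - exact: timingC.
  - exact: timing_diag.
  case/andP=> ip ps; split=> //; rewrite -p_last.
  (* The path starts at time 0, where [reach_by 0] is the identity. *)
  apply: (@reach_by_path i i p 0) => //.
    by rewrite bit_bits.
  by case: p ip ps {p_last}.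
move=> ij; split=> //; have /eqP neq := neq_ij.
have [p [p6 pj /and3P[p_uniq ip ps]]] := reach_by_journey neq ij.
have pK : map (val : 'I_6 -> nat) (map inord p) = p.
  rewrite -map_comp -[RHS]map_id; apply/eq_in_map => k /(allP p6) lt_k /=.
  by rewrite inordK.
exists (map inord p); rewrite -pK in pj p_uniq ip ps.
rewrite weighted_labelled_path; [|exact: timingC|exact: timing_diag].
split.
- by rewrite -(map_inj_uniq val_inj).
- by apply: val_inj; move: pj; rewrite last_map.
- apply/andP; split; first by rewrite path_map in ip.
  congr sorted: ps.
  by elim: (map _ p) (i) {pj p_uniq ip pK} => //= k q IH i'; rewrite IH.
Qed.

(** * Nonexistence of a strict equivalent *)

Lemma no_strict_sweep :
  search 6 (bits 6 (fun i j => bit (reach_by 4) i j)) (size (pairs 6)) (pairs 6)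
    (bits 6 (fun i j => i == j)) = false.
Proof. by vm_compute. Qed.

Theorem theorem5 :
  exists (V : finType) (G : tgraph V),
    simple_tgraph G /\
    ~ (exists H : tgraph V,
         simple_tgraph H /\
         digraph_iso (reach_graph Strict H) (reach_graph NonStrict G)).
Proof.
exists 'I_6, gadget; split; first exact: weighted_graph_simple.
case=> H [Hs [f [f' fK f'K] iso]].
(* [g i] is the vertex of [H] that the isomorphism sends to vertex [i] of the witness. *)
pose g (i : nat) := f' (inord i).
have reachE i j : i < 6 -> j < 6 ->
    reach_graph Strict H (g i) (g j) <-> i <> j /\ bit (reach_by 4) i j.
  move=> lt_i lt_j; rewrite iso /g !f'K gadget_reachP !inordK //.
  split=> -[neq ij]; split=> // eq_ij; apply: neq; first by rewrite eq_ij.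
  by rewrite -(inordK lt_i) eq_ij inordK.
suff: search 6 (bits 6 (fun i j => bit (reach_by 4) i j)) (size (pairs 6))
    (pairs 6) (bits 6 (fun i j => i == j)) by rewrite no_strict_sweep.
(* The successor of the largest label serves as [m]: the bound in [reached] is exclusive, so by then
   every edge has been swept. *)
apply: (@search_complete _ H 6 g _ _ _ (\max_(e in tedges H) label H e).+1).
- move=> i j lt_i lt_j /(can_inj f'K) eq_ij.
  by rewrite -(inordK lt_i) eq_ij inordK.
- by move=> v; exists (f v) => //; rewrite /g inord_val fK.
- move=> t i j lt_i lt_j /reached_path[p [p_uniq p_last pH _]].
  (* Reachability graphs have no loops while the swept relation is reflexive, so the diagonal is
     treated apart. *)
  have [->|neq_ij] := eqVneq i j; first exact: reach_by_refl.
  have neq_g : g i <> g j.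
    move=> /(can_inj f'K) eq_ij; case/eqP: neq_ij.
    by rewrite -(inordK lt_i) eq_ij inordK.
  have [] // := (reachE i j lt_i lt_j).1.
  by apply/simple_reachP => //; split=> //; exists p.
- move=> i j lt_i lt_j ij.
  have [->|/eqP neq_ij] := eqVneq i j.
    exact: (reached_mono (leq0n _) (eqxx (g j) : reached H 0 _ _)).
  have /simple_reachP[] // := (reachE i j lt_i lt_j).2 (conj neq_ij ij).
  move=> _ [p [_ <- pH]]; apply: path_reached => //.
  have /andP[/allP pE _] := pH; rewrite all_map; apply/allP => e /pE eH /=.
  by rewrite ltnS; apply: (leq_bigmax_cond _ eH).
Qed.
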